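(* Let $\mathcal{F}$ be a singular foliation at $(\mathbb{C}^2,p)$ and let $C$ be a reduced curve of separatrices of $\mathcal{F}$. Then $$\tau_p(\mathcal{F},C)-\tau_p(C)=GSV_p(\mathcal{F},C).$$
   Context: **Foliations.** A singular foliation $\mathcal F$ at $(\mathbb C^2,p)$ is given, in coordinates $(x,y)$ centered at $p$, by a (holomorphic or formal) 1-form $\omega=P\,dx+Q\,dy$ with $P,Q\in\mathbb C[[x,y]]$ relatively prime and vanishing at $p$. $i_p(g,h)=\dim_{\mathbb C}\mathbb C[[x,y]]/(g,h)$ is the intersection number of curves $g=0$, $h=0$. A curve $f=0$ is $\mathcal F$-invariant if $\omega\wedge df=fh\,dx\wedge dy$ for some $h\in\mathbb C[[x,y]]$. A separatrix is an irreducible (possibly formal) invariant curve; a reduced curve of separatrices is a finite union of distinct separatrices, given by a reduced equation $f=0$, $f\in\mathbb C[[x,y]]$. **Tjurina numbers.** For $C:f=0$, $\tau_p(C)=\dim_{\mathbb C}\mathbb C[[x,y]]/(f,\partial_xf,\partial_yf)$ and $\tau_p(\mathcal F,C)=\dim_{\mathbb C}\mathbb C[[x,y]]/(f,P,Q)$. **GSV-index.** For a reduced $\mathcal F$-invariant curve $C:f=0$ there are $g,h\in\mathbb C[[x,y]]$, each relatively prime to $f$, and a 1-form $\eta$ with $g\omega=h\,df+f\eta$. If $C$ is irreducible, $GSV_p(\mathcal F,C)=i_p(f,h)-i_p(f,g)$. In general, $GSV_p$ is determined by the adjunction formula $GSV_p(\mathcal F,C_1\cup C_2)=GSV_p(\mathcal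 F,C_1)+GSV_p(\mathcal F,C_2)-2i_p(C_1,C_2)$ for invariant curves without common components. (For analytic $C$ this equals $\frac1{2\pi i}\int_{\partial C}\frac gh d\left(\frac hg\right)$.) *)

(* Defs.v *)
From HB Require Import structures.
From mathcomp Require Import all_boot all_order all_algebra.
From mathcomp Require Import all_classical all_reals complex.

Set Implicit Arguments.
Unset Strict Implicit.
Unset Printing Implicit Defensive.

Import GRing.Theory.
Local Open Scope classical_set_scope.
Local Open Scope ring_scope.

(* [{fps2 K}] is K[[x,y]]; [coef2 f i j] is the coefficient of x^i y^j. *)
Record fps2 (K : comNzRingType) := Fps2 { coef2 : nat -> nat -> K }.
Notation "{ 'fps2' K }" := (fps2 K) (at level 0, format "{ 'fps2'  K }").

Section Fps2Ring.
Variable K : comNzRingType.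
Implicit Types f g h : {fps2 K}.

Lemma fps2P f g : (forall i j, coef2 f i j = coef2 g i j) <-> f = g.
Proof.
split=> [|-> //]; case: f g => [f] [g] /= fg; congr Fps2.
by apply/funext => i; apply/funext => j.
Qed.

HB.instance Definition _ := gen_eqMixin {fps2 K}.
HB.instance Definition _ := gen_choiceMixin {fps2 K}.

Definition zero2 : {fps2 K} := Fps2 (fun _ _ => 0).
Definition one2 : {fps2 K} :=
  Fps2 (fun i j => ((i == 0%N) && (j == 0%N))%:R).
Definition opp2 f : {fps2 K} := Fps2 (fun i j => - coef2 f i j).
Definition add2 f g : {fps2 K} := Fps2 (fun i j => coef2 f i j + coef2 g i j).
Definition mul2 f g : {fps2 K} := Fps2 (fun m n =>
  \sum_(i < m.+1) \sum_(j < n.+1) coef2 f i j * coef2 g (m - i) (n - j)).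
Definition scale2 (a : K) f : {fps2 K} := Fps2 (fun i j => a * coef2 f i j).

Fact add2A : associative add2.
Proof. by move=> f g h; apply/fps2P => i j /=; rewrite addrA. Qed.
Fact add2C : commutative add2.
Proof. by move=> f g; apply/fps2P => i j /=; rewrite addrC. Qed.
Fact add02 : left_id zero2 add2.
Proof. by move=> f; apply/fps2P => i j /=; rewrite add0r. Qed.
Fact addN2 : left_inverse zero2 opp2 add2.
Proof. by move=> f; apply/fps2P => i j /=; rewrite addNr. Qed.

HB.instance Definition _ :=
  GRing.isZmodule.Build {fps2 K} add2A add2C add02 addN2.

(* The ring laws are transported from K[x][y] along truncations. *)
Let agree N (p : {poly {poly K}}) f :=
  forall i j, (i < N)%N -> (j < N)%N -> p`_i`_j = coef2 f i j.

Let trunc N f : {poly {poly K}} :=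
  \poly_(i < N) \poly_(j < N) coef2 f i j.

Let agree_trunc N f : agree N (trunc N f) f.
Proof. by move=> i j iN jN; rewrite coef_poly iN coef_poly jN. Qed.

Let agree_mul N p q f g :
  agree N p f -> agree N q g -> agree N (p * q) (mul2 f g).
Proof.
move=> pf qg m n mN nN; rewrite coefM coef_sum /=; apply: eq_bigr => i _.
rewrite coefM; apply: eq_bigr => j _; rewrite pf ?qg //.
- exact: leq_ltn_trans (leq_subr _ _) mN.
- exact: leq_ltn_trans (leq_subr _ _) nN.
- exact: leq_trans (ltn_ord i) mN.
- exact: leq_trans (ltn_ord j) nN.
Qed.

Let agree_one N : agree N 1 one2.
Proof.
move=> i j _ _; rewrite coef1 /=; case: (i == 0%N) => /=; last by rewrite coef0.
by rewrite coef1.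
Qed.

Let agree_add N p q f g :
  agree N p f -> agree N q g -> agree N (p + q) (add2 f g).
Proof. by move=> pf qg i j iN jN; rewrite !coefD pf ?qg. Qed.

Let agree_eq f g : (forall N, exists2 p, agree N p f & agree N p g) -> f = g.
Proof.
move=> fg; apply/fps2P => i j; have [p pf pg] := fg (maxn i j).+1.
by rewrite -pf ?pg // ltnS ?leq_maxl ?leq_maxr.
Qed.

Fact mul2A : associative mul2.
Proof.
move=> f g h; apply: agree_eq => N.
exists (trunc N f * (trunc N g * trunc N h)); last rewrite mulrA.
- by do ?apply: agree_mul; apply: agree_trunc.
- by do ?apply: agree_mul; apply: agree_trunc.
Qed.

Fact mul2C : commutative mul2.
Proof.
move=> f g; apply: agree_eq => N.
exists (trunc N f * trunc N g); last rewrite mulrC.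
- by apply: agree_mul; apply: agree_trunc.
- by apply: agree_mul; apply: agree_trunc.
Qed.

Fact mul12 : left_id one2 mul2.
Proof.
move=> f; apply: agree_eq => N.
exists (trunc N f); last exact: agree_trunc.
by rewrite -(mul1r (trunc N f)); apply: agree_mul.
Qed.

Fact mul2Dl : left_distributive mul2 add2.
Proof.
move=> f g h; apply: agree_eq => N.
exists ((trunc N f + trunc N g) * trunc N h).
- by apply: agree_mul => //; apply: agree_add.
- by rewrite mulrDl; apply: agree_add; apply: agree_mul.
Qed.

Fact one2_neq0 : one2 != zero2.
Proof.
by apply/eqP => /fps2P /(_ 0%N 0%N) /= /eqP; rewrite oner_eq0.
Qed.

HB.instance Definition _ :=
  GRing.Zmodule_isComNzRing.Build {fps2 K} mul2A mul2C mul12 mul2Dl one2_neq0.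

Definition unit2 : {pred {fps2 K}} := fun f => `[< exists g, g * f = 1 >].
Definition inv2 f : {fps2 K} := xget f [set g | g * f = 1].

Fact mulV2 : {in unit2, left_inverse 1 inv2 *%R}.
Proof. by move=> f /asboolP fu; rewrite /inv2; case: xgetP => // /forallNP. Qed.
Fact unit2Pl f g : g * f = 1 -> unit2 f.
Proof. by move=> gf; apply/asboolP; exists g. Qed.
Fact inv2_out : {in [predC unit2], inv2 =1 id}.
Proof.
move=> f /negP fNu; rewrite /inv2; case: xgetP => //= g _ gf.
by case: fNu; apply: unit2Pl gf.
Qed.

HB.instance Definition _ :=
  GRing.ComNzRing_hasMulInverse.Build {fps2 K} mulV2 unit2Pl inv2_out.

Fact scale2A a b f : scale2 a (scale2 b f) = scale2 (a * b) f.
Proof. by apply/fps2P => i j /=; rewrite mulrA. Qed.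
Fact scale12 : left_id 1 scale2.
Proof. by move=> f; apply/fps2P => i j /=; rewrite mul1r. Qed.
Fact scale2Dr : right_distributive scale2 +%R.
Proof. by move=> a f g; apply/fps2P => i j /=; rewrite mulrDr. Qed.
Fact scale2Dl f : {morph scale2^~ f : a b / a + b}.
Proof. by move=> a b; apply/fps2P => i j /=; rewrite mulrDl. Qed.

HB.instance Definition _ :=
  GRing.Zmodule_isLmodule.Build K {fps2 K} scale2A scale12 scale2Dr scale2Dl.

Fact scale2Al a f g : a *: (f * g) = (a *: f) * g.
Proof.
apply/fps2P => m n /=; rewrite mulr_sumr; apply: eq_bigr => i _.
by rewrite mulr_sumr; apply: eq_bigr => j _; rewrite mulrA.
Qed.

HB.instance Definition _ :=
  GRing.Lmodule_isLalgebra.Build K {fps2 K} scale2Al.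

End Fps2Ring.

Section Divisibility.
Variable A : comUnitRingType.
Implicit Types a b d : A.

Definition dvdr d a := exists c, a = c * d.

Definition relprime a b :=
  forall d, dvdr d a -> dvdr d b -> d \is a GRing.unit.

Definition irreducible a :=
  [/\ a != 0, a \isn't a GRing.unit &
      forall b c, a = b * c -> b \is a GRing.unit \/ c \is a GRing.unit].

(* Two irreducible power series define the same curve iff associated. *)
Definition associated a b := exists2 u, u \is a GRing.unit & b = u * a.

Definition ideal_gen (s : seq A) : set A :=
  [set a | exists c : 'I_(size s) -> A, a = \sum_i c i * s`_i].

End Divisibility.

Section QuotientDimension.
Variables (K : fieldType) (V : lmodType K).

(* The classes of the b i form a basis of V / I. *)
Definition quot_basis (I : set V) n (b : 'I_n -> V) :=
  forall v, exists! c : 'I_n -> K, I (v - \sum_i c i *: b i).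

(* dim_K (V / I); the value is 0 by convention if V / I has infinite
   dimension. *)
Definition quot_dim (I : set V) : nat :=
  xget 0%N [set n | exists b : 'I_n -> V, quot_basis I b].

End QuotientDimension.

(* The pair (P, Q) stands for P dx + Q dy; the regular modules ^o make the
   pairs a module over K[[x,y]]. *)
Notation form1 K := ({fps2 K}^o * {fps2 K}^o)%type (only parsing).

Section Foliation.
Variable K : fieldType.
Local Notation A := {fps2 K}.
Implicit Types f g h : A.

Definition dx f : A := Fps2 (fun i j => i.+1%:R * coef2 f i.+1 j).
Definition dy f : A := Fps2 (fun i j => j.+1%:R * coef2 f i j.+1).

Definition differential f : form1 K := (dx f, dy f).

(* The coefficient of dx /\ dy. *)
Definition wedge (w e : form1 K) : A :=
  (w.1 : A) * (e.2 : A) - (w.2 : A) * (e.1 : A).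

Definition vanishes_at_origin f := coef2 f 0 0 = 0.

Definition singular_foliation (w : form1 K) :=
  [/\ relprime (w.1 : A) (w.2 : A), vanishes_at_origin w.1
    & vanishes_at_origin w.2].

Definition invariant_curve (w : form1 K) f :=
  exists h, wedge w (differential f) = f * h.

Definition separatrix w f := irreducible f /\ invariant_curve w f.

(* f = 0 is a reduced equation of a nonempty finite union of distinct
   separatrices.  A unit factor in f can be absorbed in s ord0. *)
Definition separatrix_curve w f :=
  exists n (s : 'I_n.+1 -> A),
    [/\ forall i, separatrix w (s i),
        forall i j, i != j -> ~ associated (s i) (s j)
      & f = \prod_i s i].

Definition intersection_number f g : nat := quot_dim (ideal_gen [:: f; g]).

Definition tjurina f : nat := quot_dim (ideal_gen [:: f; dx f; dy f]).

Definition tjurina_fol (w : form1 K) f : nat :=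
  quot_dim (ideal_gen [:: f; w.1 : A; w.2 : A]).

Inductive is_GSV (w : form1 K) : A -> int -> Prop :=
| GSV_irreducible f g h (e : form1 K) :
    separatrix w f -> relprime f g -> relprime f h ->
    g *: w = h *: differential f + f *: e ->
    is_GSV w f ((intersection_number f h)%:Z - (intersection_number f g)%:Z)
| GSV_adjunction f1 f2 k1 k2 :
    relprime f1 f2 -> is_GSV w f1 k1 -> is_GSV w f2 k2 ->
    is_GSV w (f1 * f2) (k1 + k2 - 2 * (intersection_number f1 f2)%:Z).

(* The unique integer produced by the rules above, independently of the choice
   of g, h, e and of the order in which the components are assembled. *)
Definition GSV (w : form1 K) f : int :=
  xget 0 [set k | is_GSV w f = [set k]].

End Foliation.

(* Main.v *)
From HB Require Import structures.
Require Import Defs.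
From mathcomp Require Import all_boot all_order all_algebra.
From mathcomp Require Import all_classical all_reals complex.
From mathcomp Require Import ring.

(** Let f be a reduced equation of C and suppose g w = h df + f e with g and h
prime to f.  Modulo f this says g.(P, Q) = h.(f_x, f_y), so (f, gP, gQ) and
(f, h f_x, h f_y) are the same ideal.  As g is a nonzerodivisor modulo f,
multiplication by g embeds A/(f, P, Q), where A = K[[x,y]], into
A/(f, gP, gQ) with cokernel A/(f, g), and likewise for h.  Computing one
dimension in two ways gives i(f, g) + tau(F, C) = i(f, h) + tau(C), that is
tau(F, C) - tau(C) = i(f, h) - i(f, g) ([tjurina_diffE]).  For irreducible f
this is the definition of the GSV index.

For C = C1 u C2 one equation g w = h d(f1 f2) + f1 f2 e yields equations for
both parts, with h replaced by h f2 for f1 and by h f1 for f2.  Additivity of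
intersection numbers then shows that tau(F, C) - tau(C) obeys the adjunction
formula ([tjurina_diffM]).  Hence every value that the GSV rules assign to f
is tau(F, C) - tau(C), and the rules do assign one to each curve of
separatrices.

Such an equation exists for every such f: expanding P f_y - Q f_x = f k shows
that g = f_x + t f_y and h = P + t Q work for every constant t, except for the
coprimality with f.  An irreducible component divides at most one member of
each of the two pencils, because it divides neither P and Q nor f_x and f_y
simultaneously; the latter uses characteristic 0.  So almost every t is
suitable ([generic_curve], [generic_curve_equation]).

What is needed about A is that coprime f, g satisfy Gauss's lemma
([relprime_gauss]) and have a quotient A/(f, g) of finite dimension
([relprime_finite_codim]).  Both come from Weierstrass division through
[regular_relprime_bezout]: when x does not divide f, some power of x lies in
(f, g). *)

Set Implicit Arguments.
Unset Strict Implicit.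
Unset Printing Implicit Defensive.

Import GRing.Theory.
Local Open Scope ring_scope.

(** * Weierstrass division *)

Section PowerSeries.
Variable K : fieldType.
Local Notation A := {fps2 K}.
Implicit Types f g h d u v : A.

Lemma coef2B f g i j : coef2 (f - g) i j = coef2 f i j - coef2 g i j.
Proof. by []. Qed.

(** Iterating T from 0, the coefficient (i, j) is stable after mu i j + 1 steps;
the stable coefficients assemble into a fixed point. *)
Lemma contraction_fixpoint (mu : nat -> nat -> nat) (T : A -> A) :
    (forall u v i j,
        (forall a b, (mu a b < mu i j)%N -> coef2 u a b = coef2 v a b) ->
      coef2 (T u) i j = coef2 (T v) i j) ->
  exists u, T u = u.
Proof.
move=> contrT; pose z n := iter n T 0.
have z_stable n p i j : (mu i j < n)%N ->
    coef2 (z n) i j = coef2 (z (n + p)%N) i j.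
  elim: n p i j => // n IHn p i j; rewrite ltnS => le_n.
  rewrite addSn /=; apply: contrT => a b lt_ab.
  by apply: IHn; exact: leq_trans lt_ab le_n.
exists (Fps2 (fun i j => coef2 (z (mu i j).+1) i j)).
apply/fps2P => i j; rewrite [RHS]/= -/(z (mu i j)); apply: contrT => a b lt_ab.
by rewrite -(subnKC lt_ab); apply: z_stable.
Qed.

(** That is, f(0, y) has order k in y. *)
Definition xregular f k :=
  coef2 f 0 k != 0 /\ forall j, (j < k)%N -> coef2 f 0 j = 0.

Lemma coef2_mul_single f g m n (i0 : 'I_m.+1) (j0 : 'I_n.+1) :
    (forall (i : 'I_m.+1) (j : 'I_n.+1), (i, j) != (i0, j0) ->
       coef2 f i j * coef2 g (m - i) (n - j) = 0) ->
  coef2 (f * g) m n = coef2 f i0 j0 * coef2 g (m - i0) (n - j0).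
Proof.
move=> zero; rewrite /= (bigD1 i0) //= (bigD1 j0) //= !big1 ?addr0 //.
  move=> i ne_i; apply: big1 => j _; apply: zero.
  by rewrite xpair_eqE (negPf ne_i).
by move=> j ne_j; apply: zero; rewrite xpair_eqE (negPf ne_j) andbF.
Qed.

(** The coefficient (i, j + k) of g - q d involves q_ij with the nonzero factor
d_0k, and otherwise only q_ab with a < i and b <= j + k, or a = i and b < j.
For the weight mu i j = i (k + 1) + j these pairs (a, b) come earlier, so
solving for q_ij makes q a fixed point of a contraction. *)
Lemma weierstrass_division d k g : xregular d k ->
  exists q, forall i j, (k <= j)%N -> coef2 (g - q * d) i j = 0.
Proof.
move=> [dk_neq0 d_lt_k].
pose T (q : A) : A := Fps2 (fun i j =>
  coef2 q i j + coef2 (g - q * d) i (j + k) / coef2 d 0 k).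
pose mu i j := (i * k.+1 + j)%N.
(* Once u vanishes at all pairs of smaller weight, a single term is left. *)
have lead u i j : (forall a b, (mu a b < mu i j)%N -> coef2 u a b = 0) ->
    coef2 (u * d) i (j + k)%N = coef2 u i j * coef2 d 0 k.
  move=> u0; have j_lt : (j < (j + k).+1)%N by rewrite ltnS leq_addr.
  rewrite (@coef2_mul_single _ _ _ _ ord_max (Ordinal j_lt)) /=.
    by rewrite subnn addKn.
  move=> a b ne_ab; have [lt_ai|] := ltnP a i.
    rewrite u0 ?mul0r // /mu.
    have le1 : (a.+1 * k.+1 <= i * k.+1)%N by rewrite leq_mul2r lt_ai orbT.
    have := ltn_ord b; rewrite ltnS => le_b.
    apply: leq_trans (leq_add le1 (leqnn j)).
    by rewrite mulSn !addSn ltnS (addnC k) -addnA leq_add2l [(k + j)%N]addnC.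
  move=> le_ia; have eq_ai : (a : nat) = i.
    by apply/eqP; rewrite eqn_leq le_ia -ltnS ltn_ord.
  have ne_bj : (b : nat) != j.
    apply: contra ne_ab => /eqP eq_bj.
    by rewrite xpair_eqE -!val_eqE /= eq_ai eq_bj !eqxx.
  rewrite eq_ai subnn; have [lt_bj|le_jb] := ltnP b j.
    by rewrite u0 ?mul0r // /mu ltn_add2l.
  rewrite d_lt_k ?mulr0 //.
  rewrite ltn_subLR; last by rewrite -ltnS.
  by rewrite ltn_add2r ltn_neqAle eq_sym ne_bj.
have [|q Tq] := @contraction_fixpoint mu T.
  move=> u v i j eq_uv; apply/eqP; rewrite -subr_eq0.
  have /lead : forall a b, (mu a b < mu i j)%N -> coef2 (u - v) a b = 0.
    by move=> a b lt_ab; rewrite coef2B eq_uv ?subrr.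
  rewrite mulrBl !coef2B => eq_lead.
  rewrite [coef2 (T u) i j]/= [coef2 (T v) i j]/= -!/(coef2 (_ * _) _ _).
  have -> : forall a b c x y z : K, a + (b - x) / z - (c + (b - y) / z)
     = (a - c) - (x - y) / z by move=> *; ring.
  by rewrite eq_lead mulfK ?subrr.
exists q => i j le_kj; have := congr1 (fun u => coef2 u i (j - k)%N) Tq.
rewrite [coef2 (T q) _ _]/= -[RHS]addr0 => /addrI /eqP.
rewrite mulf_eq0 invr_eq0 (negPf dk_neq0) orbF.
by rewrite -!/(coef2 (_ * _) _ _) subnK // => /eqP.
Qed.

(** A series with nonzero constant term is regular of order 0, and dividing 1 by
it leaves no remainder. *)
Lemma unit2P f : reflect (coef2 f 0 0 != 0) (f \is a GRing.unit).
Proof.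
apply: (iffP idP) => [/mulVr /(congr1 (fun u => coef2 u 0 0))|f0].
  rewrite /= !big_ord_recl !big_ord0 /= !addr0 => eq1.
  by apply/eqP => f0; move/eqP: eq1; rewrite f0 mulr0 eq_sym oner_eq0.
have [|q qP] := @weierstrass_division f 0 1; first by split.
apply/unitrPr; exists q; apply/eqP; rewrite mulrC eq_sym -subr_eq0; apply/eqP.
by apply/fps2P => i j; rewrite qP.
Qed.

(** * Divisibility and coprimality of power series *)

Definition monomial i0 j0 : A := Fps2 (fun i j => ((i == i0) && (j == j0))%:R).

Definition xvar : A := monomial 1 0.

Lemma coef2_xvarM f i j :
  coef2 (xvar * f) i j = if i is i'.+1 then coef2 f i' j else 0.
Proof.
case: i => [|i].
  rewrite (@coef2_mul_single _ _ _ _ ord0 ord0) /= ?mul0r // => a b _.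
  by rewrite /= (ord1 a) mul0r.
rewrite (@coef2_mul_single _ _ _ _ (Ordinal (isT : (1 < i.+2)%N)) ord0) /=.
  by rewrite mul1r subSS !subn0.
move=> a b; rewrite xpair_eqE -!val_eqE /= => /negPf ->.
by rewrite mul0r.
Qed.

Lemma coef2_xvarXM n f i j :
  coef2 (xvar ^+ n * f) i j = if (i < n)%N then 0 else coef2 f (i - n) j.
Proof.
elim: n i => [|n IHn] i; first by rewrite mul1r subn0.
by rewrite exprS -mulrA coef2_xvarM; case: i => // i; rewrite IHn subSS.
Qed.

Lemma xvar_expM_inj n : injective ( *%R (xvar ^+ n)).
Proof.
move=> f g /fps2P eq_fg; apply/fps2P => i j; have := eq_fg (i + n)%N j.
by rewrite !coef2_xvarXM ltnNge leq_addl addnK.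
Qed.

Lemma dvd_xvarX n f :
  (forall i j, (i < n)%N -> coef2 f i j = 0) -> dvdr (xvar ^+ n) f.
Proof.
move=> f0; exists (Fps2 (fun i j => coef2 f (i + n) j)).
apply/fps2P => i j; rewrite mulrC coef2_xvarXM; case: ltnP => [/f0 //|le_n].
by rewrite /= subnK.
Qed.

Lemma xregular_or_dvd f : (exists k, xregular f k) \/ dvdr xvar f.
Proof.
have [f0|] := pselect (forall j, coef2 f 0 j = 0).
  by right; apply: (@dvd_xvarX 1) => i j; rewrite ltnS leqn0 => /eqP ->.
move/existsNP => [j /eqP fj]; left.
pose P k := coef2 f 0 k != 0.
have exP : exists k, P k by exists j.
have [k Pk min_k] := ex_minnP exP; exists k; split=> // i lt_ik.
by apply: contraTeq lt_ik => /min_k; rewrite -leqNgt.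
Qed.

(** Only the variable x has to be treated apart, so no linear change of
coordinates is needed to make f regular. *)
Lemma xvar_factor f : f != 0 ->
  exists m f' k, f = xvar ^+ m * f' /\ xregular f' k.
Proof.
move=> f_neq0; pose P m := `[< exists j, coef2 f m j != 0 >].
have exP : exists m, P m.
  apply: contra_neqP f_neq0 => noP; apply/fps2P => i j; apply: contra_notP noP.
  by move=> /eqP fij; exists i; apply/asboolP; exists j.
have [m /asboolP [j fmj] min_m] := ex_minnP exP.
have [|f' eq_f] := @dvd_xvarX m f.
  move=> i l; apply: contraTeq => fil; rewrite -leqNgt min_m //.
  by apply/asboolP; exists l.
rewrite mulrC in eq_f; have [[k reg_k]|[c eq_c]] := xregular_or_dvd f'.
  by exists m, f', k.
case/eqP: fmj; rewrite eq_f coef2_xvarXM ltnn subnn eq_c mulrC.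
by rewrite coef2_xvarM.
Qed.

(** Leading coefficients in y multiply on the line x = 0. *)
Lemma xregularM f g k l :
  xregular f k -> xregular g l -> xregular (f * g) (k + l).
Proof.
move=> [fk f0] [gl g0]; split.
  have lt_k : (k < (k + l).+1)%N by rewrite ltnS leq_addr.
  rewrite (@coef2_mul_single _ _ _ _ ord0 (Ordinal lt_k)) /=.
    by rewrite addKn mulf_neq0.
  move=> i j; rewrite (ord1 i) xpair_eqE -!val_eqE /= => ne_jk.
  have [/f0 ->|le_kj] := ltnP j k; first by rewrite mul0r.
  rewrite g0 ?mulr0 // ltn_subLR; last by rewrite -ltnS.
  by rewrite ltn_add2r ltn_neqAle eq_sym ne_jk.
move=> n lt_n; rewrite /= big1 // => i _; rewrite big1 // => j _.
rewrite (ord1 i) /=; have [/f0 ->|le_kj] := ltnP j k; first by rewrite mul0r.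
rewrite g0 ?mulr0 // ltn_subLR; last by rewrite -ltnS.
by apply: leq_trans lt_n _; rewrite leq_add2r.
Qed.

Lemma mul2_eq0 f g : f * g = 0 -> f = 0 \/ g = 0.
Proof.
have [->|/xvar_factor [m [f' [k [-> regf]]]]] := eqVneq f 0; first by left.
have [->|/xvar_factor [n [g' [l [-> regg]]]]] := eqVneq g 0; first by right.
rewrite mulrACA -exprD => /fps2P /(_ (m + n)%N (k + l)%N).
rewrite coef2_xvarXM ltnn subnn => fg0.
by have [/eqP] := xregularM regf regg.
Qed.

Lemma mul2I f : f != 0 -> injective ( *%R f).
Proof.
move=> f_neq0 g h /= /eqP; rewrite -subr_eq0 -mulrBr => /eqP /mul2_eq0 [f0|].
  by rewrite f0 eqxx in f_neq0.
by move/eqP; rewrite subr_eq0 => /eqP.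
Qed.

Lemma xregular_neq0 f k : xregular f k -> f != 0.
Proof. by case=> fk _; apply: contraNneq fk => ->. Qed.

Lemma dvd_xvarX_regularM n f k g :
  xregular f k -> dvdr (xvar ^+ n) (f * g) -> dvdr (xvar ^+ n) g.
Proof.
move=> regf [c]; have [->|/xvar_factor [m [g' [l [-> regg]]]]] := eqVneq g 0.
  by exists 0; rewrite mul0r.
rewrite mulrCA [RHS]mulrC => eq_fg; apply: dvd_xvarX => i j lt_in.
rewrite coef2_xvarXM; case: ltnP => // le_mi.
have [/eqP] := xregularM regf regg; have /fps2P /(_ m (k + l)%N) := eq_fg.
by rewrite !coef2_xvarXM ltnn subnn (leq_ltn_trans le_mi lt_in).
Qed.

Lemma dvdr_trans (a b c : A) : dvdr a b -> dvdr b c -> dvdr a c.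
Proof. by move=> [p ->] [q ->]; exists (q * p); rewrite mulrA. Qed.

Lemma relprime_sym f g : relprime f g -> relprime g f.
Proof. by move=> fg d dg df; apply: fg. Qed.

(** The set J of all d such that x^n d lies in (f, g) for some n is an ideal
containing f and g, and closed under division by x.  Take d in J regular of
the least possible order l.  The Weierstrass remainder by d of an element of J
is in J and has y-degree < l; after removing a power of x it would be regular
of order < l, so it is 0.  Hence d generates J, divides f and g, and is a
unit. *)
Lemma regular_relprime_bezout f g k : xregular f k -> relprime f g ->
  exists n u v, xvar ^+ n = u * f + v * g.
Proof.
move=> regf coprime.
pose J d := exists n u v, xvar ^+ n * d = u * f + v * g.
have JB a b c : J a -> J b -> J (a - c * b).
  move=> [n [u [v eq_a]]] [m [p [q eq_b]]].
  exists (n + m)%N, (xvar ^+ m * u - c * xvar ^+ n * p).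
  exists (xvar ^+ m * v - c * xvar ^+ n * q).
  transitivity (xvar ^+ m * (xvar ^+ n * a) - c * xvar ^+ n * (xvar ^+ m * b)).
    by rewrite exprD; ring.
  by rewrite eq_a eq_b; ring.
pose P l := `[< exists2 d, J d & xregular d l >].
have Jf : J f by exists 0%N, 1, 0; rewrite !mul1r mul0r addr0.
have Jg : J g by exists 0%N, 0, 1; rewrite !mul1r mul0r add0r.
have exP : exists l, P l by exists k; apply/asboolP; exists f.
have [l /asboolP [d Jd regd] min_l] := ex_minnP exP.
have d_gen a : J a -> dvdr d a.
  move=> Ja; have [q rem0] := weierstrass_division a regd; exists q.
  apply/eqP; rewrite -subr_eq0; apply/negPn/negP => r_neq0.
  have [n [r [i [eq_r regr]]]] := xvar_factor r_neq0.
  have [m [u [v eq_uv]]] := JB _ _ q Ja Jd.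
  have /min_l le_li : P i.
    apply/asboolP; exists r => //; exists (m + n)%N, u, v.
    by rewrite -eq_uv eq_r exprD mulrA.
  have [/eqP[]] := regr; have := rem0 n i le_li.
  by rewrite eq_r coef2_xvarXM ltnn subnn.
have d_unit : d \is a GRing.unit by apply: coprime; apply: d_gen.
have [n [u [v eq_d]]] := Jd; exists n, (d^-1 * u), (d^-1 * v).
by rewrite -!mulrA -mulrDr -eq_d mulrCA mulVr ?mulr1.
Qed.

Lemma xvar_Nunit : xvar \isn't a GRing.unit.
Proof. by apply/negP => /unit2P; rewrite eqxx. Qed.

(** Otherwise x would be a common divisor. *)
Lemma relprime_regular f g : relprime f g ->
  (exists k, xregular f k) \/ (exists k, xregular g k).
Proof.
move=> coprime; have [|xf] := xregular_or_dvd f; first by left.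
have [|xg] := xregular_or_dvd g; first by right.
by have := coprime _ xf xg; rewrite (negPf xvar_Nunit).
Qed.

Lemma relprime_dvdl f f' g : dvdr f' f -> relprime f g -> relprime f' g.
Proof.
by move=> f'f coprime d df' dg; apply: coprime => //; apply: dvdr_trans f'f.
Qed.

(** If x^n = u f + v g, then f | g h gives f | x^n h, and x^n can be cancelled
when x does not divide f.  If x divides f, it does not divide g, and the power
of x in f, which must divide h, is split off first. *)
Lemma relprime_gauss f g h : relprime f g -> dvdr f (g * h) -> dvdr f h.
Proof.
have gauss_reg f' k h' : xregular f' k -> relprime f' g ->
    dvdr f' (g * h') -> dvdr f' h'.
  move=> regf coprime [c eq_c].
  have [n [u [v bez]]] := regular_relprime_bezout regf coprime.
  have eq_xh : xvar ^+ n * h' = f' * (u * h' + v * c).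
    rewrite bez mulrDl -(mulrA v) eq_c; ring.
  have [|e eq_e] := @dvd_xvarX_regularM n _ _ (u * h' + v * c) regf.
    by exists h'; rewrite -eq_xh mulrC.
  exists e; apply: (@xvar_expM_inj n); rewrite eq_xh eq_e; ring.
move=> coprime; have [[k regf]|[k regg]] := relprime_regular coprime.
  exact: gauss_reg regf coprime.
have [->|/xvar_factor [m [f' [l [eq_f regf']]]]] := eqVneq f 0.
  move=> [c]; rewrite mulr0 => /mul2_eq0 [g0|->].
    by move: (xregular_neq0 regg); rewrite g0 eqxx.
  by exists 0; rewrite mulr0.
move=> [c eq_c].
have [|h' eq_h] := @dvd_xvarX_regularM m _ _ h regg.
  by exists (c * f'); rewrite eq_c eq_f; ring.
have [||e eq_e] := gauss_reg f' _ h' regf'.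
- by apply: relprime_dvdl coprime; exists (xvar ^+ m).
- exists c; apply: (@xvar_expM_inj m) => /=.
  transitivity (g * h); first by rewrite eq_h; ring.
  by rewrite eq_c eq_f; ring.
by exists e; rewrite eq_f eq_h eq_e; ring.
Qed.

Lemma relprimeM f g h : relprime f g -> relprime f h -> relprime f (g * h).
Proof.
move=> fg fh d df dgh; apply: fh => //; apply: relprime_gauss dgh.
by apply: relprime_dvdl df fg.
Qed.

Lemma relprimeMl f g h : relprime f h -> relprime g h -> relprime (f * g) h.
Proof.
by move=> /relprime_sym fh /relprime_sym gh; apply/relprime_sym/relprimeM.
Qed.

Lemma relprimeD f g c : relprime f g -> relprime f (g + f * c).
Proof.
move=> fg d df [e eq_e]; apply: fg => //; have [a eq_a] := df.
by exists (e - a * c); rewrite mulrBl -eq_e eq_a; ring.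
Qed.

Lemma irreducible_relprime f g : irreducible f -> ~ dvdr f g -> relprime f g.
Proof.
move=> [_ _ irr] Nfg d [c eq_f] dg; case: (irr _ _ eq_f) => // c_unit.
case: Nfg; apply: dvdr_trans dg; exists c^-1.
by rewrite eq_f mulrA mulVr ?mul1r.
Qed.

Lemma irreducible_dvd_associated f g :
  irreducible f -> irreducible g -> dvdr f g -> associated f g.
Proof.
move=> [_ Nf_unit _] [_ _ irr] [c eq_g]; exists c => //.
by case: (irr _ _ eq_g) => // f_unit; rewrite f_unit in Nf_unit.
Qed.

End PowerSeries.

(** * Dimensions of quotients by subspaces *)

Section QuotientDimensionTheory.
Variables (K : fieldType) (V : lmodType K).
Implicit Types I J L : set V.

Definition subspace I := I 0 /\ forall a u v, I u -> I v -> I (a *: u + v).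

Section Subspace.
Variable I : set V.
Hypothesis subI : subspace I.

Lemma subspaceD u v : I u -> I v -> I (u + v).
Proof. by move=> Iu Iv; rewrite -(scale1r u); apply: subI.2. Qed.

Lemma subspaceZ a u : I u -> I (a *: u).
Proof.
by move=> Iu; rewrite -(addr0 (_ *: _)); apply: subI.2 => //; exact: subI.1.
Qed.

Lemma subspaceB u v : I u -> I v -> I (u - v).
Proof. by move=> Iu Iv; rewrite addrC -scaleN1r; apply: subI.2. Qed.

Lemma subspace_sum n (F : 'I_n -> V) : (forall i, I (F i)) -> I (\sum_i F i).
Proof.
by move=> IF; elim/big_rec: _ => [|i u _]; [exact: subI.1 | apply: subspaceD].
Qed.
End Subspace.

(** The two halves of [quot_basis]: existence and uniqueness of coordinates. *)
Definition spans_mod I n (b : 'I_n -> V) :=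
  forall v, exists c : 'I_n -> K, I (v - \sum_i c i *: b i).

Definition free_mod I n (b : 'I_n -> V) :=
  forall c : 'I_n -> K, I (\sum_i c i *: b i) -> forall i, c i = 0.

Definition finite_codim I := exists n (b : 'I_n -> V), spans_mod I b.

Lemma quot_basisP I n (b : 'I_n -> V) : subspace I ->
  quot_basis I b <-> spans_mod I b /\ free_mod I b.
Proof.
move=> subI; split=> [basis_b|[span_b free_b] v].
  split=> [v|c Ic i]; first by have [c [Ic _]] := basis_b v; exists c.
  have [c0 [_ uniq_c0]] := basis_b 0.
  have <- : c0 = c.
    apply: uniq_c0; rewrite sub0r -scaleN1r; exact: subspaceZ.
  rewrite (uniq_c0 (fun=> 0)) // sub0r -scaleN1r; apply: subspaceZ => //.
  by rewrite big1 => [|j _]; [exact: subI.1 | exact: scale0r].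
have [c Ic] := span_b v; exists c; split=> // c' Ic'.
apply/funext => i; apply/eqP; rewrite -subr_eq0; apply/eqP.
apply: (free_b (fun i => c i - c' i)).
under eq_bigr do rewrite scalerBl.
rewrite sumrB; have := subspaceB subI Ic' Ic.
by rewrite opprB addrC addrA subrK.
Qed.

Lemma spans_modS I J n (b : 'I_n -> V) :
  (forall v, I v -> J v) -> spans_mod I b -> spans_mod J b.
Proof.
by move=> sIJ span_b v; have [c Ic] := span_b v; exists c; apply: sIJ.
Qed.

Lemma finite_codimS I J :
  (forall v, I v -> J v) -> finite_codim I -> finite_codim J.
Proof. by move=> sIJ [n [b span_b]]; exists n, b; apply: spans_modS span_b. Qed.

(** A spanning family of minimal size is free: a relation c among its members
with c_i <> 0 would make b_i redundant. *)
Lemma finite_codim_basis I : subspace I -> finite_codim I ->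
  exists n (b : 'I_n -> V), spans_mod I b /\ free_mod I b.
Proof.
move=> subI fin; pose P n := `[< exists b : 'I_n -> V, spans_mod I b >].
have exP : exists n, P n by have [n bP] := fin; exists n; apply/asboolP.
have [n /asboolP [b span_b] min_n] := ex_minnP exP.
exists n, b; split=> // c Ic i; apply/eqP/negPn/negP => ci_neq0.
case: n => [|n] in b span_b min_n c Ic i ci_neq0 *; first by case: i ci_neq0.
suff /min_n : P n by rewrite ltnn.
apply/asboolP; exists (fun j => b (lift i j)) => v.
have [c' Ic'] := span_b v.
exists (fun j => c' (lift i j) - c' i / c i * c (lift i j)).
have := subspaceD subI Ic' (subspaceZ subI (c' i / c i) Ic); congr I.
rewrite -addrA; congr (_ + _); rewrite [\sum_k c' k *: b k](bigD1_ord i) //.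
rewrite [\sum_k c k *: b k](bigD1_ord i) //=.
rewrite scalerDr scalerA divfK // opprD addrACA addNr add0r.
rewrite scaler_sumr -!sumrN -big_split /=; apply: eq_bigr => j _.
by rewrite scalerBl opprB scalerA addrC.
Qed.

(** The matrix expressing b' in terms of b modulo I has independent rows. *)
Lemma span_free_leq I m n (b : 'I_n -> V) (b' : 'I_m -> V) :
  subspace I -> spans_mod I b -> free_mod I b' -> (m <= n)%N.
Proof.
move=> subI span_b free_b'.
have [M MP] := choice (fun j => span_b (b' j)).
pose A : 'M[K]_(m, n) := \matrix_(j, i) M j i.
suff A_free : row_free A by rewrite -(eqP A_free) rank_leq_col.
apply/row_freeP; apply/row_freeP/inj_row_free => u uA.
apply/rowP => j; rewrite mxE; apply: free_b'.
have IM : I (\sum_j u 0 j *: (b' j - \sum_i M j i *: b i)).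
  by apply: subspace_sum => // k; apply: subspaceZ.
congr I : IM; under eq_bigr do rewrite scalerBr scaler_sumr.
rewrite sumrB exchange_big /= [X in _ - X]big1 ?subr0 // => i _.
under eq_bigr do rewrite scalerA.
rewrite -scaler_suml; have /rowP /(_ i) := uA; rewrite !mxE.
by under eq_bigr do rewrite mxE; move=> ->; rewrite scale0r.
Qed.

Lemma quot_dimE I n (b : 'I_n -> V) :
  subspace I -> spans_mod I b -> free_mod I b -> quot_dim I = n.
Proof.
move=> subI span_b free_b; rewrite /quot_dim; case: xgetP => [m _ /=|noP].
  move=> [b' /(quot_basisP _ subI) [span_b' free_b']].
  apply/eqP; rewrite eqn_leq (span_free_leq subI span_b free_b').
  exact: span_free_leq subI span_b' free_b.
by case: (noP n); exists b; apply/quot_basisP.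
Qed.

(** The exact sequence 0 -> V/L -> V/I -> V/J -> 0 whose first map is induced by
phi: the hypotheses say that J = I + phi(V) and that L is the preimage
of I. *)
Lemma quot_dim_additive I J L (phi : {linear V -> V}) :
    subspace I -> subspace J -> subspace L ->
    (forall v, J v <-> exists a, I (v - phi a)) ->
    (forall a, L a <-> I (phi a)) ->
    finite_codim J -> finite_codim L ->
  quot_dim I = (quot_dim J + quot_dim L)%N.
Proof.
move=> subI subJ subL JP LP.
move=> /(finite_codim_basis subJ) [n [b [span_b free_b]]].
move=> /(finite_codim_basis subL) [m [c [span_c free_c]]].
rewrite (quot_dimE subJ span_b free_b) (quot_dimE subL span_c free_c).
pose e k := match fintype.split k with inl i => b i | inr j => phi (c j) end.
have sum_e (p : 'I_(n + m) -> K) : \sum_k p k *: e k =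
    \sum_i p (lshift m i) *: b i + phi (\sum_j p (rshift n j) *: c j).
  rewrite big_split_ord linear_sum /=; congr (_ + _); apply: eq_bigr => i _.
    by rewrite /e (unsplitK (inl _ i)).
  by rewrite /e (unsplitK (inr _ i)) linearZ.
apply: (quot_dimE (b := e)) => // [v|p].
  have [p /JP [a Ia]] := span_b v; have [q /LP Iq] := span_c a.
  exists (fun k => match fintype.split k with inl i => p i | inr j => q j end).
  have := subspaceD subI Ia Iq; congr I; rewrite sum_e.
  rewrite linearB /= addrA subrK -addrA -opprD; congr (_ - (_ + phi _)).
    by apply: eq_bigr => i _; rewrite (unsplitK (inl _ i)).
  by apply: eq_bigr => i _; rewrite (unsplitK (inr _ i)).
rewrite sum_e => Ip.
have p0 : forall i, p (lshift m i) = 0.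
  apply: free_b; apply/JP; exists (- \sum_j p (rshift n j) *: c j).
  by rewrite linearN opprK.
have q0 : forall j, p (rshift n j) = 0.
  apply: free_c; apply/LP; move: Ip; rewrite big1 ?add0r // => i _.
  by rewrite p0 scale0r.
by move=> k; rewrite -(splitK k); case: (fintype.split k) => i /=.
Qed.

End QuotientDimensionTheory.

(** * Intersection numbers *)

Section Ideals.
Variable K : fieldType.
Local Notation A := {fps2 K}.
Implicit Types (f g h d u v : A) (s : seq A).

Lemma ideal_gen2P f g u :
  ideal_gen [:: f; g] u <-> exists p q, u = p * f + q * g.
Proof.
split=> [[c ->]|[p [q ->]]].
  exists (c ord0), (c (lift ord0 ord0)).
  by rewrite !big_ord_recl big_ord0 addr0.
exists (fun i => if i == 0%N :> nat then p else q).
by rewrite !big_ord_recl big_ord0 addr0.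
Qed.

Lemma ideal_gen3P f g h u :
  ideal_gen [:: f; g; h] u <-> exists p q r, u = p * f + (q * g + r * h).
Proof.
split=> [[c ->]|[p [q [r ->]]]].
  exists (c ord0), (c (lift ord0 ord0)), (c (lift ord0 (lift ord0 ord0))).
  by rewrite !big_ord_recl big_ord0 addr0.
exists (fun i => nth 0 [:: p; q; r] i).
by rewrite !big_ord_recl big_ord0 addr0.
Qed.

Lemma ideal_gen_subspace s : subspace (ideal_gen s).
Proof.
split; first by exists (fun=> 0); rewrite big1 // => i _; rewrite mul0r.
move=> a u v [p ->] [q ->]; exists (fun i => a *: p i + q i).
rewrite scaler_sumr -big_split; apply: eq_bigr => i _.
by rewrite mulrDl scalerAl.
Qed.

Section MulBy.
Variable g : A.

Let mul_by : A -> A := *%R g.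

Let mul_by_linear : linear mul_by.
Proof.
move=> a u v; rewrite /mul_by mulrDr; congr (_ + _).
by rewrite !(mulrC g) scalerAl.
Qed.

HB.instance Definition _ :=
  GRing.isLinear.Build K A A *:%R mul_by mul_by_linear.

(** Additivity for multiplication by a power series g.  The hypotheses are
stated with the ring operations rather than a bundled linear map, so that
they can be checked by ring identities. *)
Lemma quot_dim_mul_additive (s1 s2 s3 : seq A) :
    (forall v, ideal_gen s2 v <-> exists a, ideal_gen s1 (v - g * a)) ->
    (forall a, ideal_gen s3 a <-> ideal_gen s1 (g * a)) ->
    finite_codim (ideal_gen s2) -> finite_codim (ideal_gen s3) ->
  quot_dim (ideal_gen s1) =
    (quot_dim (ideal_gen s2) + quot_dim (ideal_gen s3))%N.
Proof.
by apply: (@quot_dim_additive _ _ _ _ _ mul_by); apply: ideal_gen_subspace.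
Qed.
End MulBy.

(** For f regular of order k and x^n in (f, g), the monomials x^i y^j with i < n
and j < k span the quotient: Weierstrass division by f bounds the y-degree,
and x^n kills the rest. *)
Lemma relprime_finite_codim f g :
  relprime f g -> finite_codim (ideal_gen [:: f; g]).
Proof.
have fin_reg f' g' k : xregular f' k -> relprime f' g' ->
    finite_codim (ideal_gen [:: f'; g']).
  move=> regf coprime.
  have [n [u [v bez]]] := regular_relprime_bezout regf coprime.
  pose b (p : 'I_n * 'I_k) : A := monomial K p.1 p.2.
  exists #|{: 'I_n * 'I_k}|, (fun i => b (enum_val i)) => w.
  have [q rem0] := weierstrass_division w regf.
  set r := w - q * f' in rem0.
  have eq_w : w = q * f' + r by rewrite addrC subrK.
  move: r rem0 eq_w => r rem0 eq_w; pose c (p : 'I_n * 'I_k) := coef2 r p.1 p.2.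
  exists (fun i => c (enum_val i)).
  rewrite -(big_enum_val (fun p => c p *: b p)) /=.
  set low := \sum_(_ in _) _.
  have [e eq_e] : dvdr (xvar K ^+ n) (r - low).
    apply: dvd_xvarX => i j lt_in; rewrite coef2B.
    have -> : coef2 low i j = \sum_p coef2 (c p *: b p) i j.
      rewrite /low; elim/big_rec2: _ => // p x y _ <-; by [].
    have [le_kj|lt_jk] := leqP k j.
      rewrite rem0 // big1 ?subr0 // => -[a e] _ /=.
      by rewrite (gtn_eqF (leq_trans (ltn_ord e) le_kj)) andbF mulr0.
    rewrite (bigD1 (Ordinal lt_in, Ordinal lt_jk)) //= !eqxx mulr1.
    rewrite big1 ?addr0 ?subrr // => -[a e] /=.
    rewrite xpair_eqE -!val_eqE /= ![_ == i]eq_sym ![_ == j]eq_sym.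
    by move/negPf => ->; rewrite mulr0.
  apply/ideal_gen2P; exists (q + e * u), (e * v).
  rewrite (_ : w - low = q * f' + (r - low)); last by rewrite eq_w addrA.
  by rewrite eq_e bez; ring.
move=> coprime; have [[k regf]|[k regg]] := relprime_regular coprime.
  exact: fin_reg regf coprime.
apply: finite_codimS (fin_reg _ _ _ regg (relprime_sym coprime)) => u.
move/ideal_gen2P => [p [q ->]]; apply/ideal_gen2P.
by exists q, p; rewrite addrC.
Qed.

(** The sequence A/(f1, g) -> A/(f1 f2, g) -> A/(f2, g), whose first map is
multiplication by f2, is exact; the first map is injective by Gauss's
lemma. *)
Lemma intersection_numberM f1 f2 g :
    relprime f1 g -> relprime f2 g -> f2 != 0 ->
  intersection_number (f1 * f2) g =
    (intersection_number f1 g + intersection_number f2 g)%N.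
Proof.
move=> f1g f2g f2_neq0; rewrite addnC.
apply: (@quot_dim_mul_additive f2); try exact: relprime_finite_codim.
- move=> v; split=> [/ideal_gen2P [p [q ->]]|[a /ideal_gen2P [p [q eq_v]]]].
    by exists p; apply/ideal_gen2P; exists 0, q; ring.
  apply/ideal_gen2P; exists (p * f1 + a), q.
  by rewrite -[v](subrK (f2 * a)) eq_v; ring.
- move=> a; split=> /ideal_gen2P [p [q eq_a]]; apply/ideal_gen2P.
    by exists p, (q * f2); rewrite eq_a; ring.
  have [|c eq_q] := @relprime_gauss _ f2 g q f2g.
    by exists (a - p * f1); rewrite mulrBl (mulrC a) eq_a; ring.
  exists p, c; apply: (mul2I f2_neq0); rewrite /= eq_a eq_q; ring.
Qed.

(** As g is a nonzerodivisor modulo f, multiplication by g identifies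
A/(f, a, b) with the kernel of A/(f, ga, gb) -> A/(f, g). *)
Lemma quot_dim_mul f g a b : relprime f g ->
    finite_codim (ideal_gen [:: f; a; b]) ->
  quot_dim (ideal_gen [:: f; g * a; g * b]) =
    (intersection_number f g + quot_dim (ideal_gen [:: f; a; b]))%N.
Proof.
move=> fg fin_ab.
apply: (@quot_dim_mul_additive g) => //; try exact: relprime_finite_codim.
- move=> v; split=> [/ideal_gen2P [p [q ->]]|[c /ideal_gen3P [p [q [r eq_v]]]]].
    by exists q; apply/ideal_gen3P; exists p, 0, 0; ring.
  apply/ideal_gen2P; exists p, (q * a + r * b + c).
  by rewrite -[v](subrK (g * c)) eq_v; ring.
- move=> c; split=> /ideal_gen3P [p [q [r eq_c]]]; apply/ideal_gen3P.
    by exists (g * p), q, r; rewrite eq_c; ring.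
  have [|e eq_e] := @relprime_gauss _ f g (c - (q * a + r * b)) fg.
    exists p; rewrite mulrBr eq_c; ring.
  by exists e, q, r; rewrite -eq_e subrK.
Qed.
End Ideals.

(** * Partial derivatives and generic members of pencils *)

Section Derivations.
Variable K : fieldType.
Local Notation A := {fps2 K}.
Implicit Types f g h : A.

(** Leibniz's rule in one variable, for the product of two formal series: weigh
the antidiagonal terms by m + 1 = i + (m + 1 - i). *)
Lemma sum_antidiag_deriv (F : nat -> nat -> K) m :
  m.+1%:R * (\sum_(i < m.+2) F i (m.+1 - i)%N) =
    \sum_(i < m.+1) i.+1%:R * F i.+1 (m - i)%N +
    \sum_(i < m.+1) (m - i).+1%:R * F i (m - i).+1.
Proof.
pose G (i : nat) := F i (m.+1 - i)%N.
transitivity (\sum_(i < m.+2) i%:R * G i + \sum_(i < m.+2) (m.+1 - i)%:R * G i).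
  rewrite -big_split mulr_sumr; apply: eq_bigr => i _ /=.
  by rewrite -mulrDl -natrD subnKC // -ltnS.
congr (_ + _); first by rewrite big_ord_recl mul0r add0r; apply: eq_bigr.
rewrite big_ord_recr /= subnn mul0r addr0; apply: eq_bigr => i _.
by rewrite /G /= subSn // -ltnS.
Qed.

Lemma dxM f g : dx (f * g) = dx f * g + f * dx g.
Proof.
apply/fps2P => m n /=.
pose F i l := \sum_(j < n.+1) coef2 f i j * coef2 g l (n - j).
rewrite (sum_antidiag_deriv F); congr (_ + _); apply: eq_bigr => i _.
  by rewrite mulr_sumr; apply: eq_bigr => j _; rewrite mulrA.
by rewrite mulr_sumr; apply: eq_bigr => j _; rewrite mulrCA.
Qed.

Lemma dyM f g : dy (f * g) = dy f * g + f * dy g.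
Proof.
apply/fps2P => m n /=; rewrite mulr_sumr -big_split; apply: eq_bigr => i _ /=.
rewrite (sum_antidiag_deriv (fun j l => coef2 f i j * coef2 g (m - i) l)).
congr (_ + _); apply: eq_bigr => j _; first by rewrite mulrA.
by rewrite mulrCA.
Qed.

Hypothesis char0 : [pchar K] =i pred0.

(** In characteristic 0, differentiating a term of lowest total degree gives
a term of degree one less, which no multiple of f contains. *)
Lemma irreducible_Ndvd_partials f :
  irreducible f -> dvdr f (dx f) -> dvdr f (dy f) -> False.
Proof.
move=> [f_neq0 Nf_unit _] [p eq_x] [q eq_y].
pose P k := `[< exists i j, (i + j = k)%N /\ coef2 f i j != 0 >].
have exP : exists k, P k.
  apply: contra_neqP f_neq0 => noP; apply/fps2P => i j; apply: contra_notP noP.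
  by move=> /eqP fij; exists (i + j)%N; apply/asboolP; exists i, j.
have [k /asboolP [i [j [eq_k fij]]] min_k] := ex_minnP exP.
have low r a b : (a + b < k)%N -> coef2 (r * f) a b = 0.
  move=> lt_k; rewrite /= big1 // => c _; rewrite big1 // => e _.
  apply/eqP; rewrite mulf_eq0; apply/orP; right; apply: contraTT lt_k => fce.
  rewrite -leqNgt.
  apply: leq_trans (min_k _ _) (leq_add (leq_subr c a) (leq_subr e b)).
  by apply/asboolP; exists (a - c)%N, (b - e)%N.
have natr_neq0 n : n.+1%:R != 0 :> K by rewrite ((pcharf0P K).1 char0).
case: i j eq_k fij => [|i] [|j] eq_k fij.
- by case/negP: Nf_unit; apply/unit2P.
- case/negP: fij; have /fps2P /(_ 0%N j) := eq_y.
  rewrite low; last by rewrite -eq_k.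
  by move/eqP; rewrite /= mulf_eq0 (negPf (natr_neq0 _)).
- case/negP: fij; have /fps2P /(_ i 0%N) := eq_x.
  rewrite low; last by rewrite -eq_k.
  by move/eqP; rewrite /= mulf_eq0 (negPf (natr_neq0 _)).
- case/negP: fij; have /fps2P /(_ i j.+1) := eq_x.
  rewrite low; last by rewrite -eq_k.
  by move/eqP; rewrite /= mulf_eq0 (negPf (natr_neq0 _)).
Qed.

Lemma ex_notin_seq (l : seq K) : exists t, t \notin l.
Proof.
pose ts : seq K := [seq n%:R | n <- iota 0 (size l).+1].
apply: contrapT => noT; suff : (size ts <= size l)%N.
  by rewrite size_map size_iota ltnn.
apply: uniq_leq_size => [|t _].
  rewrite map_inj_uniq ?iota_uniq // => m n.
  wlog le_mn : m n / (m <= n)%N.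
    move=> th eq_mn.
    by case/orP: (leq_total m n) => le_mn; [|symmetry]; apply: th.
  move/eqP; rewrite eq_sym -subr_eq0 -natrB // ((pcharf0P K).1 char0).
  rewrite subn_eq0 => le_nm.
  by apply/eqP; rewrite eqn_leq le_mn.
by apply: contrapT => /negP Nt; apply: noT; exists t.
Qed.

Definition generically (P : K -> Prop) :=
  exists l : seq K, forall t, t \notin l -> P t.

Lemma generically_and P Q :
  generically P -> generically Q -> exists t, P t /\ Q t.
Proof.
move=> [l1 P1] [l2 Q2]; have [t] := ex_notin_seq (l1 ++ l2).
rewrite mem_cat negb_or => /andP [t1 t2].
by exists t; split; [apply: P1 | apply: Q2].
Qed.

Lemma generically_relprimeM f1 f2 (u : K -> A) :
    generically (fun t => relprime f1 (u t)) ->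
    generically (fun t => relprime f2 (u t)) ->
  generically (fun t => relprime (f1 * f2) (u t)).
Proof.
move=> [l1 P1] [l2 Q2]; exists (l1 ++ l2) => t.
rewrite mem_cat negb_or => /andP [t1 t2].
by apply: relprimeMl; [apply: P1 | apply: Q2].
Qed.

(** If f divides two members of the pencil, it divides both g and h; so at most
one value of t is excluded. *)
Lemma generically_relprime_pencil f g h : irreducible f ->
    ~ (dvdr f g /\ dvdr f h) ->
  generically (fun t => relprime f (g + t%:A * h)).
Proof.
move=> irr Nfgh.
have [[t0 dvd_t0]|no_t] :=
  pselect (exists t, dvdr f (g + t%:A * h)); last first.
  exists [::] => t _; apply: irreducible_relprime => // dvd_t.
  by apply: no_t; exists t.
exists [:: t0] => t; rewrite inE => ne_t.
apply: irreducible_relprime => // dvd_t.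
apply: Nfgh; have [p eq_p] := dvd_t0; have [q eq_q] := dvd_t.
have dt_neq0 : t - t0 != 0 by rewrite subr_eq0.
have eq_h : h = ((t - t0)^-1)%:A * (q - p) * f.
  have -> : h = ((t - t0)^-1)%:A * ((t - t0)%:A * h).
    by rewrite mulrA -scalerAl mul1r scalerA mulVf // scale1r mul1r.
  rewrite -mulrA; congr (_ * _); rewrite [RHS]mulrBl -eq_p -eq_q scalerBl.
  by rewrite mulrBl opprD addrACA subrr add0r.
split; last by exists (((t - t0)^-1)%:A * (q - p)).
exists (p - t0%:A * (((t - t0)^-1)%:A * (q - p))).
rewrite mulrBl -eq_p -mulrA -eq_h.
by rewrite addrK.
Qed.
End Derivations.

(** * Tjurina numbers and the GSV index *)

Section GSVTjurina.
Variable K : fieldType.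
Local Notation A := {fps2 K}.
Implicit Types f g h : A.

Lemma intersection_numberC f g :
  intersection_number f g = intersection_number g f.
Proof.
congr (quot_dim _); apply/predeqP => u.
split=> /ideal_gen2P [p [q ->]]; apply/ideal_gen2P; exists q, p;
  by rewrite addrC.
Qed.

Lemma intersection_numberMr f g h : relprime f g -> relprime f h -> h != 0 ->
  intersection_number f (g * h) =
    (intersection_number f g + intersection_number f h)%N.
Proof.
move=> /relprime_sym gf /relprime_sym hf h_neq0.
rewrite (intersection_numberC f (g * h)) (intersection_numberM gf hf h_neq0).
by rewrite (intersection_numberC g f) (intersection_numberC h f).
Qed.

Lemma subz_eq_of_addn_eq (a b c d : nat) :
  (a + b = c + d)%N -> b%:Z - d%:Z = c%:Z - a%:Z.
Proof.
move/(congr1 Posz); rewrite !PoszD => eq_sum; apply/eqP.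
by rewrite subr_eq addrAC eq_sym subr_eq -eq_sum addrC.
Qed.

Lemma form1_equationP (w : form1 K) f g h :
  (exists e : form1 K, g *: w = h *: differential f + f *: e) <->
  (exists e1 e2 : A, g * (w.1 : A) = h * dx f + f * e1 /\
                     g * (w.2 : A) = h * dy f + f * e2).
Proof.
split=> [[e eqn]|[e1 [e2 [eq1 eq2]]]].
  exists e.1, e.2.
  by split; [exact: (congr1 fst eqn) | exact: (congr1 snd eqn)].
exists (e1, e2); rewrite [LHS]surjective_pairing [RHS]surjective_pairing.
by congr pair; [exact: eq1 | exact: eq2].
Qed.

Definition GSV_equation (w : form1 K) f g h :=
  [/\ relprime f g, relprime f h
    & exists e : form1 K, g *: w = h *: differential f + f *: e].

Definition tjurina_diff w f : int := (tjurina_fol w f)%:Z - (tjurina f)%:Z.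

(** The ideals (f, gP, gQ) and (f, h f_x, h f_y) coincide, and [quot_dim_mul]
computes the dimension of the quotient in both forms. *)
Lemma tjurina_diffE w f g h :
    finite_codim (ideal_gen [:: f; w.1 : A; w.2 : A]) ->
    finite_codim (ideal_gen [:: f; dx f; dy f]) ->
    GSV_equation w f g h ->
  tjurina_diff w f =
    (intersection_number f h)%:Z - (intersection_number f g)%:Z.
Proof.
move=> finw findf [fg fh /form1_equationP [e1 [e2 [eq_gP eq_gQ]]]].
set P : A := w.1 in eq_gP; set Q : A := w.2 in eq_gQ.
have eq_ideal : ideal_gen [:: f; g * P; g * Q] =
    ideal_gen [:: f; h * dx f; h * dy f].
  apply/predeqP => u; split=> /ideal_gen3P [p [q [r ->]]]; apply/ideal_gen3P.
    by exists (p + q * e1 + r * e2), q, r; rewrite eq_gP eq_gQ; ring.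
  by exists (p - q * e1 - r * e2), q, r; rewrite eq_gP eq_gQ; ring.
have eq_sum : (intersection_number f g + tjurina_fol w f =
    intersection_number f h + tjurina f)%N.
  transitivity (quot_dim (ideal_gen [:: f; g * P; g * Q])).
    by symmetry; exact: quot_dim_mul fg finw.
  by rewrite eq_ideal; exact: quot_dim_mul fh findf.
exact: subz_eq_of_addn_eq eq_sum.
Qed.

(** These conditions hold for each separatrix and pass to coprime products, so
the components of f need not be recorded.  As both coprimality conditions hold
for almost all t, a single t suits both pencils. *)
Definition generic_curve (w : form1 K) f :=
  [/\ f != 0, invariant_curve w f,
      generically (fun t => relprime f ((w.1 : A) + t%:A * (w.2 : A)))
    & generically (fun t => relprime f (dx f + t%:A * dy f))].

Hypothesis char0 : [pchar K] =i pred0.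

Lemma generic_curve_finite w f : generic_curve w f ->
  finite_codim (ideal_gen [:: f; w.1 : A; w.2 : A]) /\
  finite_codim (ideal_gen [:: f; dx f; dy f]).
Proof.
move=> [_ _ gen_w gen_df].
have [t [fh fg]] := generically_and char0 gen_w gen_df.
split; [apply: finite_codimS (relprime_finite_codim fh) |
        apply: finite_codimS (relprime_finite_codim fg)] => u;
  by move=> /ideal_gen2P [p [q ->]]; apply/ideal_gen3P;
     exists p, q, (q * t%:A); rewrite mulrDr mulrA.
Qed.

(** Writing P f_y - Q f_x = f k, one has
(f_x + t f_y) w = (P + t Q) df + f k (t dx - dy). *)
Lemma generic_curve_equation w f : generic_curve w f ->
  exists g h, GSV_equation w f g h /\
    tjurina_diff w f =
      (intersection_number f h)%:Z - (intersection_number f g)%:Z.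
Proof.
move=> gen; have [finw findf] := generic_curve_finite gen.
have [_ [k eq_k] gen_w gen_df] := gen.
have [t [fh fg]] := generically_and char0 gen_w gen_df.
set h := (w.1 : A) + _ in fh; set g := dx f + _ in fg; exists g, h.
suff eqn : GSV_equation w f g h.
  by split=> //; apply: tjurina_diffE eqn.
split=> //; apply/form1_equationP; exists (t%:A * k), (- k); rewrite /g /h.
move: eq_k; rewrite /wedge /=.
move: (w.1 : A) (w.2 : A) (t%:A : A) => P Q T eq_k; split.
  transitivity ((P + T * Q) * dx f + T * (P * dy f - Q * dx f)); first by ring.
  by rewrite eq_k; ring.
transitivity ((P + T * Q) * dy f - (P * dy f - Q * dx f)); first by ring.
by rewrite eq_k; ring.
Qed.

(** A separatrix is not a unit, so it cannot divide both P and Q, which are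
coprime. *)
Lemma separatrix_generic w f :
  singular_foliation w -> separatrix w f -> generic_curve w f.
Proof.
move=> [PQ _ _] [irr inv]; have [f_neq0 Nf_unit _] := irr; split=> //.
  apply: generically_relprime_pencil => // -[fP fQ].
  by have := PQ _ fP fQ; rewrite (negPf Nf_unit).
apply: generically_relprime_pencil => // -[fx fy].
exact: irreducible_Ndvd_partials irr fx fy.
Qed.

(** Modulo f1, the member of the pencil of partials of f1 f2 is f2 times the
corresponding member for f1. *)
Lemma generic_curveM w f1 f2 : relprime f1 f2 ->
  generic_curve w f1 -> generic_curve w f2 -> generic_curve w (f1 * f2).
Proof.
move=> f12 [f1_neq0 [k1 inv1] gw1 [l1 gd1]] [f2_neq0 [k2 inv2] gw2 [l2 gd2]].
split.
- by apply/eqP => /mul2_eq0 [] /eqP; apply/negP.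
- exists (k1 + k2); move: inv1 inv2; rewrite /wedge /= dxM dyM => inv1 inv2.
  transitivity ((w.1 * dy f1 - w.2 * dx f1) * f2 +
                (w.1 * dy f2 - w.2 * dx f2) * f1); first by ring.
  by rewrite inv1 inv2; ring.
- exact: generically_relprimeM.
- apply: generically_relprimeM; [exists l1 => t tl | exists l2 => t tl].
    have -> : dx (f1 * f2) + t%:A * dy (f1 * f2) =
        f2 * (dx f1 + t%:A * dy f1) + f1 * (dx f2 + t%:A * dy f2).
      by rewrite dxM dyM; move: (t%:A : A) => T; ring.
    by apply/relprimeD/relprimeM => //; apply: gd1.
  have -> : dx (f1 * f2) + t%:A * dy (f1 * f2) =
      f1 * (dx f2 + t%:A * dy f2) + f2 * (dx f1 + t%:A * dy f1).
    by rewrite dxM dyM; move: (t%:A : A) => T; ring.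
  by apply/relprimeD/relprimeM; [exact: relprime_sym | apply: gd2].
Qed.

(** An equation g w = h d(f1 f2) + f1 f2 e reads
g w = (h f2) df1 + f1 (h df2 + f2 e), an equation for f1, and symmetrically
for f2.  The correction terms i(f1, f2) come from the extra factors f2
and f1. *)
Lemma tjurina_diffM w f1 f2 : relprime f1 f2 ->
    generic_curve w f1 -> generic_curve w f2 ->
  tjurina_diff w (f1 * f2) =
    tjurina_diff w f1 + tjurina_diff w f2 - 2 * (intersection_number f1 f2)%:Z.
Proof.
move=> f12 gen1 gen2.
have [g [h [[f12g f12h]]]] :=
  generic_curve_equation (generic_curveM f12 gen1 gen2).
move=> /form1_equationP [e1 [e2 [eq1 eq2]]] ->.
rewrite dxM in eq1; rewrite dyM in eq2.
have [f1g f2g] : relprime f1 g /\ relprime f2 g.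
  by split; apply: relprime_dvdl f12g; [exists f2; rewrite mulrC | exists f1].
have [f1h f2h] : relprime f1 h /\ relprime f2 h.
  by split; apply: relprime_dvdl f12h; [exists f2; rewrite mulrC | exists f1].
have [f1_neq0 _ _ _] := gen1; have [f2_neq0 _ _ _] := gen2.
have f21 := relprime_sym f12.
have [fin1w fin1] := generic_curve_finite gen1.
have [fin2w fin2] := generic_curve_finite gen2.
have eqn1 : GSV_equation w f1 g (h * f2).
  split=> //; first exact: relprimeM.
  apply/form1_equationP; exists (h * dx f2 + f2 * e1), (h * dy f2 + f2 * e2).
  by rewrite eq1 eq2; split; ring.
have eqn2 : GSV_equation w f2 g (h * f1).
  split=> //; first exact: relprimeM.
  apply/form1_equationP; exists (h * dx f1 + f1 * e1), (h * dy f1 + f1 * e2).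
  by rewrite eq1 eq2; split; ring.
rewrite (tjurina_diffE fin1w fin1 eqn1) (tjurina_diffE fin2w fin2 eqn2).
rewrite (intersection_numberM f1h f2h f2_neq0).
rewrite (intersection_numberM f1g f2g f2_neq0).
rewrite (intersection_numberMr f1h f12 f2_neq0).
rewrite (intersection_numberMr f2h f21 f1_neq0).
rewrite (intersection_numberC f2 f1).
move: (intersection_number f1 h) (intersection_number f2 h) => h1 h2.
move: (intersection_number f1 g) (intersection_number f2 g) => g1 g2.
by move: (intersection_number f1 f2) => i12; rewrite !PoszD; ring.
Qed.

Lemma is_GSV_tjurina_diff w f k : singular_foliation w -> is_GSV w f k ->
  generic_curve w f /\ k = tjurina_diff w f.
Proof.
move=> sing.
elim=> {f k} [f g h e sep fg fh eqn|f1 f2 k1 k2 f12 _ [gen1 ->] _ [gen2 ->]].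
  have gen := separatrix_generic sing sep; split=> //.
  have [finw fin] := generic_curve_finite gen.
  by rewrite (@tjurina_diffE w f g h) //; split=> //; exists e.
by split; [exact: generic_curveM | rewrite tjurina_diffM].
Qed.

(** The components are added one at a time; each is prime to the product of the
preceding ones because nonassociated irreducible series are coprime. *)
Lemma separatrix_curve_is_GSV w f :
  singular_foliation w -> separatrix_curve w f -> exists k, is_GSV w f k.
Proof.
move=> sing [n [s [sep_s Nassoc ->]]].
have sep_GSV f0 : separatrix w f0 -> exists k, is_GSV w f0 k.
  move=> sep; have [g [h [[fg fh [e eqn]] _]]] :=
    generic_curve_equation (separatrix_generic sing sep).
  by eexists; apply: GSV_irreducible eqn.
elim: n s sep_s Nassoc => [|n IHn] s sep_s Nassoc.
  by rewrite big_ord1; apply: sep_GSV.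
rewrite big_ord_recr /=.
have [|i j ne_ij|k1 GSV1] := IHn (fun i => s (widen_ord (leqnSn _) i)).
- by move=> i; apply: sep_s.
- by apply: Nassoc; rewrite -val_eqE.
have [k2 GSV2] := sep_GSV _ (sep_s ord_max).
eexists; apply: GSV_adjunction GSV1 GSV2.
apply: (big_ind (fun f => relprime f (s ord_max))) => [d d1 _|f1 f2|i _].
- by have [c /esym cd1] := d1; apply/unitrPr; exists c; rewrite mulrC.
- exact: relprimeMl.
have [irr_i _] := sep_s (widen_ord (leqnSn n.+1) i).
apply: irreducible_relprime => // /(irreducible_dvd_associated irr_i) assoc.
apply: (Nassoc (widen_ord (leqnSn n.+1) i) ord_max).
  by rewrite -val_eqE /= ltn_eqF.
by apply: assoc; case: (sep_s ord_max).
Qed.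

(** [GSV] selects a value only when the rules produce exactly one, which is what
the two preceding lemmas establish together. *)
Lemma GSV_tjurina w f : singular_foliation w -> separatrix_curve w f ->
  GSV w f = tjurina_diff w f.
Proof.
move=> sing sep; have [k GSVk] := separatrix_curve_is_GSV sing sep.
have [_ eq_k] := is_GSV_tjurina_diff sing GSVk.
have GSV_set : is_GSV w f = [set tjurina_diff w f]%classic.
  apply/seteqP; split=> l /=; last by move=> ->; rewrite -eq_k.
  by move=> /(is_GSV_tjurina_diff sing) [].
rewrite /GSV; case: xgetP => [l _ /= eq_l|/(_ (tjurina_diff w f)) []//].
have : is_GSV w f l by rewrite eq_l.
by move=> /(is_GSV_tjurina_diff sing) [].
Qed.

End GSVTjurina.

Theorem proposition6p2 (R : realType) (w : form1 R[i]) (f : {fps2 R[i]})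
  (hw : singular_foliation w) (hf : separatrix_curve w f) :
  (tjurina_fol w f)%:Z - (tjurina f)%:Z = GSV w f.
Proof.
symmetry; apply: GSV_tjurina => //; exact: Num.Theory.pchar_num.
Qed.
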